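(* Let $\mathcal{M}$ be an episodic MDP with $S$ states, $A$ actions, horizon $H$, and suppose episodes are collected by an adaptive learner. Let $\mathcal{Z}\subseteq[H]\times\mathcal{S}\times\mathcal{A}$ and suppose that, for some $\epsilon_0>0$, $\max_\pi p_h^\pi(s,a)\le\epsilon_0$ for all $(h,s,a)\notin\mathcal{Z}$. Let $\delta\in(0,1)$. With probability at least $1-\delta$, for any $t\ge t_0:=\inf\{t:n_h^t(s,a)\ge1,\ \forall(h,s,a)\in\mathcal{Z}\}$, any deterministic policy $\pi\in\Pi^D$ and any reward function $r\in[0,1]^{SAH}$, $$\Big|\sum_{h,s,a}\big(\widehat{p}_h^{\pi,t}(s,a)-p_h^\pi(s,a)\big)r_h(s,a)\Big|\le\sqrt{\beta^{RF}(t,\delta)\sum_{(h,s,a)\in\mathcal{Z}}\frac{p_h^\pi(s,a)^2}{n_h^t(s,a)}}+(SH-Z_\pi)H\epsilon_0,$$ where $Z_\pi:=|\mathcal{Z}\cap\{(h,s,\pi_h(s)):h\in[H],s\in\mathcal{S}\}|$ and $\beta^{RF}(t,\delta):=4H^2\log(1/\delta)+24SH^3\log(A(1+t))$.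
   Context: $\mathcal{M}=(\mathcal{S},\mathcal{A},\{p_h\}_{h\in[H]},s_1,H)$ is a finite-horizon MDP. In each episode $t=1,2,\dots$ the learner plays a policy $\pi^t$, chosen based on past observations, starting from $s_1$, and observes $(s_h^t,a_h^t,s_{h+1}^t)_{h\in[H]}$ with $s_{h+1}^t\sim p_h(\cdot|s_h^t,a_h^t)$. $n_h^t(s,a)$ is the number of visits to $(s,a)$ at stage $h$ in the first $t$ episodes, and $\widehat{p}_h^t(\cdot|s,a)$ the corresponding empirical transition frequencies (maximum likelihood estimator; an arbitrary distribution if $n_h^t(s,a)=0$). $\Pi^D$ is the set of deterministic policies $\pi=\{\pi_h:\mathcal{S}\to\mathcal{A}\}_{h\in[H]}$. $p_h^\pi(s,a)$ is the probability of visiting $(s,a)$ at stage $h$ when playing $\pi$ from $s_1$ under transitions $p$, and $\widehat{p}_h^{\pi,t}(s,a)$ the same quantity under transitions $\widehat{p}^t$. *)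

(* Defs.v *)
From HB Require Import structures.
From mathcomp Require Import all_boot all_order all_algebra.
From mathcomp Require Import all_classical all_reals all_analysis.

Set Implicit Arguments.
Unset Strict Implicit.
Unset Printing Implicit Defensive.

Import Order.TTheory GRing.Theory Num.Theory.

Local Open Scope classical_set_scope.
Local Open Scope ring_scope.

(* Stages are 0-based: h : 'I_H stands for stage h + 1. *)
Definition transitions (R : realType) (S A : finType) (H : nat) : Type :=
  'I_H -> S -> A -> S -> R.

Definition policy (R : realType) (S A : finType) (H : nat) : Type :=
  'I_H -> S -> A -> R.

Definition det_policy (S A : finType) (H : nat) : Type := 'I_H -> S -> A.

Definition is_distr (R : realType) (T : finType) (q : T -> R) : Prop :=
  (forall x, 0 <= q x) /\ \sum_x q x = 1.

Definition is_kernel (R : realType) (S A : finType) (H : nat)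
    (p : transitions R S A H) : Prop :=
  forall h s a, is_distr (p h s a).

Definition is_policy (R : realType) (S A : finType) (H : nat)
    (pi : policy R S A H) : Prop :=
  forall h s, is_distr (pi h s).

Definition policy_of_det (R : realType) (S A : finType) (H : nat)
    (pi : det_policy S A H) : policy R S A H :=
  fun h s a => (pi h s == a)%:R.

(* An episode is made of H + 1 states (the last one is reached after the last
   action) and H actions. *)
Definition episode (S A : finType) (H : nat) : finType :=
  ({ffun 'I_H.+1 -> S} * {ffun 'I_H -> A})%type.

Definition state_at (S A : finType) (H : nat) (e : episode S A H)
    (h : 'I_H) : S := e.1 (widen_ord (leqnSn H) h).

Definition action_at (S A : finType) (H : nat) (e : episode S A H)
    (h : 'I_H) : A := e.2 h.

Definition next_state_at (S A : finType) (H : nat) (e : episode S A H)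
    (h : 'I_H) : S := e.1 (lift ord0 h).

Definition episode_prob (R : realType) (S A : finType) (H : nat)
    (p : transitions R S A H) (s1 : S) (pi : policy R S A H)
    (e : episode S A H) : R :=
  (e.1 ord0 == s1)%:R *
  \prod_(h < H) (pi h (state_at e h) (action_at e h) *
                 p h (state_at e h) (action_at e h) (next_state_at e h)).

Definition visit_prob (R : realType) (S A : finType) (H : nat)
    (p : transitions R S A H) (s1 : S) (pi : policy R S A H)
    (h : 'I_H) (s : S) (a : A) : R :=
  \sum_(e : episode S A H | (state_at e h == s) && (action_at e h == a))
    episode_prob p s1 pi e.

(* X k and pol k are the trajectory and the policy of episode k + 1; F k is the
   information available after k episodes.  F k may be larger than the
   sigma-algebra generated by the observations, so that the learner may use
   private randomness; law says that, given F k, episode k + 1 is distributed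
   as an episode in which pol k is played from s1. *)
Record adaptive_sampling (R : realType) (S A : finType) (H : nat)
    (d : measure_display) (Omega : measurableType d) (P : probability Omega R)
    (p : transitions R S A H) (s1 : S) (F : nat -> set (set Omega))
    (pol : nat -> Omega -> policy R S A H)
    (X : nat -> Omega -> episode S A H) : Prop := AdaptiveSampling {
  filtration_sigma : forall k, sigma_algebra setT (F k);
  filtration_sub : forall k, F k `<=` measurable;
  filtration_mono : forall k, F k `<=` F k.+1;
  policy_wf : forall k w, is_policy (pol k w);
  policy_predictable : forall k h s a (Y : set R), measurable Y ->
    F k ((fun w => pol k w h s a) @^-1` Y);
  episode_adapted : forall k e, F k.+1 (X k @^-1` [set e]);
  episode_law : forall k (B : set Omega) e, F k B ->
    P (B `&` X k @^-1` [set e]) =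
    (\int[P]_(w in B) (episode_prob p s1 (pol k w) e)%:E)%E
}.

(* In the counts below, x : nat -> episode S A H is a realised sequence of
   episodes, of which the first t are used. *)
Definition visit_count (S A : finType) (H : nat) (x : nat -> episode S A H)
    (t : nat) (h : 'I_H) (s : S) (a : A) : nat :=
  #|[set k : 'I_t | (state_at (x k) h == s) && (action_at (x k) h == a)]|.

Definition transition_count (S A : finType) (H : nat)
    (x : nat -> episode S A H) (t : nat) (h : 'I_H) (s : S) (a : A) (s' : S)
    : nat :=
  #|[set k : 'I_t | [&& state_at (x k) h == s, action_at (x k) h == a
                      & next_state_at (x k) h == s']]|.

(* q is only required to be a distribution at the unvisited (h, s, a). *)
Definition is_empirical_kernel (R : realType) (S A : finType) (H : nat)
    (x : nat -> episode S A H) (t : nat) (q : transitions R S A H) : Prop :=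
  is_kernel q /\
  forall h s a s', (0 < visit_count x t h s a)%N ->
    q h s a s' = (transition_count x t h s a s')%:R /
                 (visit_count x t h s a)%:R.

(* Valued in the extended reals, so that the infimum is +oo if some element of
   Z is never visited. *)
Definition cover_time (R : realType) (S A : finType) (H : nat)
    (x : nat -> episode S A H) (Z : {set 'I_H * S * A}) : \bar R :=
  ereal_inf [set (u%:R)%:E | u in
    [set u : nat | forall h s a, (h, s, a) \in Z ->
                     (1 <= visit_count x u h s a)%N]].

Definition on_policy_card (S A : finType) (H : nat) (Z : {set 'I_H * S * A})
    (pi : det_policy S A H) : nat :=
  #|Z :&: [set (h, s, pi h s) | h in 'I_H, s in S]%SET|.

Definition beta_RF (R : realType) (nS nA H t : nat) (delta : R) : R :=
  4%:R * H%:R ^+ 2 * ln (1 / delta) +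
  24%:R * nS%:R * H%:R ^+ 3 * ln (nA%:R * (1 + t%:R)).

(* Main.v *)
Require Import Defs.
From HB Require Import structures.
From mathcomp Require Import all_boot all_order all_algebra.
From mathcomp Require Import all_classical all_reals all_analysis.
From mathcomp Require Import measurable_realfun.
From mathcomp Require Import ring lra.

Set Implicit Arguments.
Unset Strict Implicit.
Unset Printing Implicit Defensive.

Import Order.TTheory GRing.Theory Num.Theory.

Local Open Scope classical_set_scope.
Local Open Scope ring_scope.

(* Write V for the value function of pi under phat.  The simulation lemma turns
   the left-hand side into the sum over (h, s) of p_h^pi(s, pi_h(s)) times
   (phat_h - p_h)(.|s, pi_h(s)) applied to V_{h+1}, where V_{h+1} takes its
   values in [0, H - 1].  The pairs outside Z contribute at most H eps0 each.
   For the pairs in Z, V is rounded down to the grid of mesh H / (1 + t), so that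
   policies, rounded value functions and vectors of visit counts range over a
   set of log-cardinality of order SH log(A (1 + t)).  Once these are fixed, the
   exponential weights with parameters proportional to p_h^pi / n_h form a
   supermartingale (Hoeffding's lemma), and Markov's inequality bounds the
   weighted deviation by sqrt(2 L H^2 sum (p_h^pi)^2 / n_h).  Fixing the counts
   in the union bound makes the tilting parameters deterministic, and no maximal
   inequality is needed since there is also a union bound over t. *)

(** * Exponential moments of bounded variables *)

Section Hoeffding.
Variable R : realType.
Implicit Types x b : R.

(** The left-over function vanishes at 0 and its derivative [y * (expR y - expR (- y))] is
    nonnegative on the half-line. Its sign drives the monotonicity argument of the next lemma. *)
Lemma sinh_le_mul_cosh x :
  0 <= x -> 0 <= x * (expR x + expR (- x)) - (expR x - expR (- x)).
Proof.
pose f x : R := x * (expR x + expR (- x)) - (expR x - expR (- x)).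
have df y : is_derive (y : R) 1 f (y * (expR y - expR (- y))).
  rewrite /f; apply: is_derive_eq; rewrite /GRing.scale /=; ring.
move=> x0; rewrite -[leLHS](_ : f 0 = 0); last first.
  by rewrite /f oppr0 subrr mul0r subr0.
have := @ger0_derive1_ndecr R f 0 x; apply=> //.
move=> y; rewrite in_itv /= => /andP[y0 _]; rewrite derive1E derive_val.
by rewrite mulr_ge0 1?ltW // subr_gt0 ltr_expR; lra.
apply: derivable_within_continuous => y _; exact: ex_derive.
Qed.

(** The ratio [g] of the two sides, up to the factor 2, is nonincreasing on the half-line: its
    derivative is minus the quantity of [sinh_le_mul_cosh] times a positive factor. At 0 it equals
    2. *)
Lemma cosh_le_expR_sqr b : 0 <= b -> expR b + expR (- b) <= 2 * expR (b ^+ 2 / 2).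
Proof.
pose g x : R := (expR x + expR (- x)) * expR (- (x ^+ 2 / 2)).
have dg y : is_derive (y : R) 1 g
    (- (y * (expR y + expR (- y)) - (expR y - expR (- y))) * expR (- (y ^+ 2 / 2))).
  rewrite /g; apply: is_derive_eq; rewrite /GRing.scale /= ?expr1; by field.
move=> b0.
have : g b <= g 0.
  apply: (@ler0_derive1_nincr R g 0 b) => // [y|].
    rewrite in_itv /= => /andP[y0 _]; rewrite derive1E derive_val.
    by rewrite mulr_le0_ge0 ?expR_ge0 // oppr_le0 sinh_le_mul_cosh // ltW.
  apply: derivable_within_continuous => y _; exact: ex_derive.
rewrite /g oppr0 expr0n /= mul0r oppr0 expR0 mulr1 -(ler_pM2r (expR_gt0 (b ^+ 2 / 2))).
by rewrite -mulrA -expRD addNr expR0 mulr1.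
Qed.

Lemma expR_chord_le b x : 0 < b -> `|x| <= b ->
  expR x <= (expR b + expR (- b)) / 2 + x * ((expR b - expR (- b)) / (2 * b)).
Proof.
move=> b0; rewrite ler_norml => /andP[x1 x2].
(* This is the weight of [b] when [x] is written as a convex combination of [b] and [- b]. *)
have t0 : 0 <= (b + x) / (2 * b) by rewrite divr_ge0 //; lra.
have t1 : (b + x) / (2 * b) <= 1 by rewrite ler_pdivrMr; lra.
have := @convex_expR R (Itv01 t0 t1) b (- b).
rewrite !convRE /=.
set e1 := expR b; set e2 := expR (- b).
rewrite [X in expR X <= _](_ : _ = x); last by rewrite /unstable.onem; field; lra.
move/le_trans; apply; rewrite le_eqVlt; apply/orP; left; apply/eqP.
by rewrite /unstable.onem; field; lra.
Qed.

(** Averaging the chord bound kills its linear part because [x] is centred, which leaves the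
    hyperbolic cosine of [b]. The case [b = 0] is separate since the slope of the chord divides by
    [b]. *)
Lemma hoeffding_mgf_le (T : finType) (q : T -> R) (x : T -> R) b :
  is_distr q -> \sum_i q i * x i = 0 -> 0 <= b -> (forall i, `|x i| <= b) ->
  \sum_i q i * expR (x i) <= expR (b ^+ 2 / 2).
Proof.
move=> [q0 q1] qx; rewrite le_eqVlt => /orP[/eqP <-|b0] xb.
  have x0 i : x i = 0 by apply/eqP; rewrite -normr_le0; exact: xb.
  under eq_bigr => i _ do rewrite x0 expR0 mulr1.
  by rewrite q1 expr0n mul0r expR0.
apply: (@le_trans _ _ ((expR b + expR (- b)) / 2)); last first.
  by rewrite ler_pdivrMr // mulrC cosh_le_expR_sqr // ltW.
rewrite [leRHS](_ : _ = \sum_i q i * ((expR b + expR (- b)) / 2 +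
    x i * ((expR b - expR (- b)) / (2 * b)))).
  by apply: ler_sum => i _; rewrite ler_wpM2l // expR_chord_le.
under eq_bigr => i _ do rewrite mulrDr [X in _ + X]mulrA.
by rewrite big_split /= -!mulr_suml q1 qx mul1r mul0r addr0.
Qed.

End Hoeffding.

(** * Expectations along an episode and the simulation lemma *)

Section Episodes.
Variables (R : realType) (S A : finType).

Definition tail_stages (T : Type) (H : nat) (f : 'I_H.+1 -> T) : 'I_H -> T :=
  fun h => f (lift ord0 h).

(** The first state of [e] becomes the state reached after playing [a] in [s]. Every longer episode
    arises in exactly one way, so expectations can be computed by induction on the horizon. *)
Definition cons_episode (H : nat) (s : S) (a : A) (e : episode S A H) :
    episode S A H.+1 :=
  ([ffun i => oapp e.1 s (unlift ord0 i)], [ffun i => oapp e.2 a (unlift ord0 i)]).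

Lemma state_at_cons0 H s a (e : episode S A H) :
  state_at (cons_episode s a e) ord0 = s.
Proof.
rewrite /state_at ffunE.
rewrite (_ : widen_ord _ _ = ord0) ?unlift_none //.
exact: val_inj.
Qed.

Lemma state_at_consS H s a (e : episode S A H) h :
  state_at (cons_episode s a e) (lift ord0 h) = state_at e h.
Proof.
rewrite /state_at ffunE.
rewrite (_ : widen_ord _ _ = lift ord0 (widen_ord (leqnSn H) h)) ?liftK //.
exact: val_inj.
Qed.

Lemma action_at_cons0 H s a (e : episode S A H) :
  action_at (cons_episode s a e) ord0 = a.
Proof. by rewrite /action_at ffunE unlift_none. Qed.

Lemma action_at_consS H s a (e : episode S A H) h :
  action_at (cons_episode s a e) (lift ord0 h) = action_at e h.
Proof. by rewrite /action_at ffunE liftK. Qed.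

Lemma next_state_at_cons0 H s a (e : episode S A H) :
  next_state_at (cons_episode s a e) ord0 = e.1 ord0.
Proof. by rewrite /next_state_at ffunE liftK. Qed.

Lemma next_state_at_consS H s a (e : episode S A H) h :
  next_state_at (cons_episode s a e) (lift ord0 h) = next_state_at e h.
Proof. by rewrite /next_state_at ffunE liftK. Qed.

Lemma sum_episodeS H (f : episode S A H.+1 -> R) :
  \sum_e f e = \sum_s \sum_a \sum_(e : episode S A H) f (cons_episode s a e).
Proof.
rewrite pair_big pair_big /=.
rewrite (reindex (fun x : (S * A) * episode S A H =>
  cons_episode x.1.1 x.1.2 x.2)) //=.
exists (fun e : episode S A H.+1 => ((e.1 ord0, e.2 ord0),
  ([ffun i => e.1 (lift ord0 i)], [ffun i => e.2 (lift ord0 i)]))).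
- move=> [[s a] [u v]] _ /=; rewrite !ffunE !unlift_none /=.
  by congr (_, (_, _)); apply/ffunP => i; rewrite !ffunE liftK.
- move=> [u v] _ /=; congr (_, _); apply/ffunP => i; rewrite !ffunE;
  by case: unliftP => [j|] -> //=; rewrite ffunE.
Qed.

Section Expectation.
Variables (H : nat) (p : transitions R S A H.+1) (pi : policy R S A H.+1).

Lemma episode_prob_cons s1 s a (e : episode S A H) :
  episode_prob p s1 pi (cons_episode s a e) =
  (s == s1)%:R * (pi ord0 s a * p ord0 s a (e.1 ord0) *
    episode_prob (tail_stages p) (e.1 ord0) (tail_stages pi) e).
Proof.
rewrite /episode_prob ffunE unlift_none /= eqxx mul1r big_ord_recl.
rewrite state_at_cons0 action_at_cons0 next_state_at_cons0.
congr (_ * (_ * _)); apply: eq_bigr => h _.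
by rewrite state_at_consS action_at_consS next_state_at_consS.
Qed.

Lemma expectation_episodeS s1 (f : episode S A H.+1 -> R) :
  \sum_e episode_prob p s1 pi e * f e =
  \sum_a pi ord0 s1 a * \sum_s' p ord0 s1 a s' *
    \sum_e episode_prob (tail_stages p) s' (tail_stages pi) e *
      f (cons_episode s1 a e).
Proof.
rewrite sum_episodeS (bigD1 s1) //= [X in _ + X]big1 ?addr0; last first.
  move=> s /negbTE ns; apply: big1 => a _; apply: big1 => e _.
  by rewrite episode_prob_cons ns !mul0r.
apply: eq_bigr => a _; rewrite mulr_sumr.
under [RHS]eq_bigr => s' _ do rewrite !mulr_sumr.
rewrite exchange_big /=; apply: eq_bigr => e _.
(* Only [s' = e.1 ord0] contributes, since [episode_prob] carries the indicator of the initial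
   state. *)
rewrite episode_prob_cons eqxx mul1r (bigD1 (e.1 ord0)) //=.
rewrite [X in _ = _ + X]big1 ?addr0; first by rewrite !mulrA.
move=> s /negbTE ns; rewrite /episode_prob [e.1 ord0 == s]eq_sym ns.
by rewrite !(mul0r, mulr0).
Qed.

End Expectation.

Lemma expectation_episode0 (p : transitions R S A 0) pi s1 (f : _ -> R) :
  (forall e, f e = 1) -> \sum_e episode_prob p s1 pi e * f e = 1.
Proof.
move=> f1; pose e0 : episode S A 0 := ([ffun=> s1], ffun0 (card_ord 0)).
rewrite (bigD1 e0) //= [X in _ + X]big1 ?addr0.
  by rewrite f1 /episode_prob big_ord0 ffunE eqxx !mul1r.
move=> e ne; rewrite /episode_prob; case: eqP => [e1|_]; last by rewrite !mul0r.
case/negP: ne; rewrite /e0; case: e e1 => u v /= us; apply/eqP; congr (_, _).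
  by apply/ffunP => i; rewrite ffunE ord1.
by apply/ffunP => -[].
Qed.

Lemma tail_kernel H (p : transitions R S A H.+1) :
  is_kernel p -> is_kernel (tail_stages p).
Proof. by move=> kp h; exact: kp. Qed.

Lemma tail_policy H (pi : policy R S A H.+1) :
  is_policy pi -> is_policy (tail_stages pi).
Proof. by move=> kp h; exact: kp. Qed.

Lemma is_policy_of_det H (pi : det_policy S A H) :
  is_policy (policy_of_det R pi).
Proof.
move=> h s; split=> [a|]; first exact: ler0n.
rewrite (bigD1 (pi h s)) //= /policy_of_det eqxx big1 ?addr0 //.
by move=> a; rewrite eq_sym => /negbTE ->.
Qed.

Lemma episode_prob_ge0 H (p : transitions R S A H) s1 pi e :
  is_kernel p -> is_policy pi -> 0 <= episode_prob p s1 pi e.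
Proof.
move=> kp kpi; rewrite mulr_ge0 ?ler0n // prodr_ge0 // => h _.
by rewrite mulr_ge0 ?(kpi _ _).1 ?(kp _ _ _).1.
Qed.

Lemma sum_episode_prob H (p : transitions R S A H) s1 pi :
  is_kernel p -> is_policy pi -> \sum_e episode_prob p s1 pi e = 1.
Proof.
elim: H p s1 pi => [|H IH] p s1 pi kp kpi;
  under eq_bigr => e _ do rewrite -[episode_prob _ _ _ _]mulr1.
  exact: expectation_episode0.
rewrite (expectation_episodeS p pi s1 (fun=> 1)) -[RHS](kpi ord0 s1).2.
apply: eq_bigr => a _; rewrite -[RHS]mulr1 -[X in _ = _ * X](kp ord0 s1 a).2;
  congr (_ * _).
apply: eq_bigr => s' _; rewrite -mulr_suml IH /= ?mulr1 //.
  exact: tail_kernel.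
exact: tail_policy.
Qed.

(** The one-step bound holds for every state and action, hence for whatever policy is played.
    Conditioning on the first transition, the product over the later stages has mean at most 1 by
    induction. *)
Lemma expectation_prod_le1 H (p : transitions R S A H) s1 pi
    (g : 'I_H -> S -> A -> S -> R) :
  is_kernel p -> is_policy pi ->
  (forall h s a s', 0 <= g h s a s') ->
  (forall h s a, \sum_s' p h s a s' * g h s a s' <= 1) ->
  \sum_e episode_prob p s1 pi e *
    \prod_h g h (state_at e h) (action_at e h) (next_state_at e h) <= 1.
Proof.
elim: H p s1 pi g => [|H IH] p s1 pi g kp kpi g0 g1.
  by rewrite expectation_episode0 // => e; rewrite big_ord0.
rewrite (expectation_episodeS p pi s1 (fun e => \prod_h _)).
rewrite -[leRHS](kpi ord0 s1).2; apply: ler_sum => a _.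
rewrite ler_piMr ?(kpi _ _).1 //; apply: le_trans (g1 ord0 s1 a).
apply: ler_sum => s' _; rewrite ler_wpM2l ?(kp _ _ _).1 //.
rewrite -[leRHS]mulr1 -subr_ge0.
have := IH (tail_stages p) s' (tail_stages pi) (tail_stages g)
  (tail_kernel kp) (tail_policy kpi) (fun h => g0 _) (fun h => g1 _).
move=> /(ler_wpM2l (g0 ord0 s1 a s')); rewrite subr_ge0; apply: le_trans.
rewrite mulr_sumr; apply: ler_sum => e _.
rewrite big_ord_recl state_at_cons0 action_at_cons0 next_state_at_cons0.
(* Tails that do not start at [s'] have probability 0 on both sides. *)
rewrite /episode_prob; case: eqP => [->|_]; last by rewrite !mul0r mulr0.
rewrite mulrCA le_eqVlt; apply/orP; left; apply/eqP.
congr (_ * (_ * _)); apply: eq_bigr => h _.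
by rewrite state_at_consS action_at_consS next_state_at_consS.
Qed.

Lemma visit_prob_ge0 H (p : transitions R S A H) s1 pi h s a :
  is_kernel p -> is_policy pi -> 0 <= visit_prob p s1 pi h s a.
Proof. by move=> kp kpi; apply: sumr_ge0 => e _; exact: episode_prob_ge0. Qed.

Lemma visit_probE H (p : transitions R S A H) s1 pi h s a :
  visit_prob p s1 pi h s a =
  \sum_e episode_prob p s1 pi e *
    ((state_at e h == s) && (action_at e h == a))%:R.
Proof.
by rewrite /visit_prob big_mkcond; apply: eq_bigr => e _; case: ifP;
  rewrite (mulr1, mulr0).
Qed.

Lemma visit_prob_recl0 H (p : transitions R S A H.+1) s1 pi s a :
  is_kernel p -> is_policy pi ->
  visit_prob p s1 pi ord0 s a = (s1 == s)%:R * pi ord0 s1 a.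
Proof.
move=> kp kpi; rewrite visit_probE expectation_episodeS.
rewrite (bigD1 a) //= [X in _ + X]big1 ?addr0.
  rewrite mulrC; congr (_ * _).
  rewrite -[RHS]mul1r -[X in _ = X * _](kp ord0 s1 a).2 mulr_suml; apply: eq_bigr => s' _.
  under eq_bigr => e _ do rewrite state_at_cons0 action_at_cons0 eqxx andbT.
  rewrite -mulr_suml sum_episode_prob ?mul1r //.
  - exact: tail_kernel.
  - exact: tail_policy.
move=> b /negbTE ne; rewrite big1 ?mulr0 // => s' _; rewrite big1 ?mulr0 // => e _.
by rewrite action_at_cons0 ne andbF mulr0.
Qed.

Lemma visit_prob_reclS H (p : transitions R S A H.+1) s1 pi h s a :
  visit_prob p s1 pi (lift ord0 h) s a =
  \sum_b pi ord0 s1 b * \sum_s' p ord0 s1 b s' *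
    visit_prob (tail_stages p) s' (tail_stages pi) h s a.
Proof.
rewrite visit_probE expectation_episodeS; apply: eq_bigr => b _; congr (_ * _).
apply: eq_bigr => s' _; congr (_ * _); rewrite visit_probE.
by apply: eq_bigr => e _; rewrite state_at_consS action_at_consS.
Qed.

Lemma sum_visit_prob H (p : transitions R S A H) s1 pi h :
  is_kernel p -> is_policy pi -> \sum_s \sum_a visit_prob p s1 pi h s a = 1.
Proof.
move=> kp kpi; rewrite pair_big /= -(sum_episode_prob s1 kp kpi).
under eq_bigr => x _ do rewrite visit_probE.
rewrite exchange_big /=; apply: eq_bigr => e _; rewrite -mulr_sumr.
rewrite (bigD1 (state_at e h, action_at e h)) //= !eqxx big1 ?addr0 ?mulr1 //.
move=> [s a]; rewrite xpair_eqE /=.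
by rewrite (eq_sym s) (eq_sym a) => /negbTE ->.
Qed.

Lemma sum_det (f : A -> R) (b : A) : \sum_a (b == a)%:R * f a = f b.
Proof.
rewrite (bigD1 b) //= eqxx mul1r big1 ?addr0 // => a.
by rewrite eq_sym => /negbTE ->; rewrite mul0r.
Qed.

Definition value H (p : transitions R S A H) (pi : det_policy S A H)
    (r : 'I_H -> S -> A -> R) (s1 : S) : R :=
  \sum_h \sum_s \sum_a visit_prob p s1 (policy_of_det R pi) h s a * r h s a.

(** The Bellman equation, recovered from the definition of the value through visit probabilities. *)
Lemma valueS H (p : transitions R S A H.+1) pi r s1 : is_kernel p ->
  value p pi r s1 = r ord0 s1 (pi ord0 s1) +
    \sum_s' p ord0 s1 (pi ord0 s1) s' *
      value (tail_stages p) (tail_stages pi) (tail_stages r) s'.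
Proof.
move=> kp; rewrite /value big_ord_recl; congr (_ + _).
  under eq_bigr => s _ do under eq_bigr => a _ do
    rewrite (visit_prob_recl0 _ _ _ kp (is_policy_of_det pi)) -mulrA.
  under eq_bigr => s _ do rewrite -mulr_sumr sum_det.
  rewrite (bigD1 s1) //= eqxx mul1r big1 ?addr0 // => s.
  by rewrite eq_sym => /negbTE ->; rewrite mul0r.
under [RHS]eq_bigr => s' _ do rewrite mulr_sumr.
rewrite [RHS]exchange_big /=; apply: eq_bigr => h _.
under [RHS]eq_bigr => s' _ do rewrite mulr_sumr.
rewrite [RHS]exchange_big /=; apply: eq_bigr => s _.
under [RHS]eq_bigr => s' _ do rewrite mulr_sumr.
rewrite [RHS]exchange_big /=; apply: eq_bigr => a _.
rewrite visit_prob_reclS sum_det mulr_suml.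
by apply: eq_bigr => s' _; rewrite mulrA.
Qed.

Lemma value_bounds H (p : transitions R S A H) pi (r : 'I_H -> S -> A -> R) s1 :
  is_kernel p -> (forall h s a, 0 <= r h s a <= 1) -> 0 <= value p pi r s1 <= H%:R.
Proof.
move=> kp r01; have kpi := is_policy_of_det pi.
have v0 h s a : 0 <= visit_prob p s1 (policy_of_det R pi) h s a.
  exact: visit_prob_ge0.
apply/andP; split.
  apply: sumr_ge0 => h _; apply: sumr_ge0 => s _; apply: sumr_ge0 => a _.
  by rewrite mulr_ge0 //; have /andP[] := r01 h s a.
rewrite [leRHS](_ : _ = \sum_(h < H) 1); last first.
  by rewrite sumr_const card_ord.
apply: ler_sum => h _; rewrite -(sum_visit_prob s1 h kp kpi).
apply: ler_sum => s _; apply: ler_sum => a _.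
by rewrite ler_piMr //; have /andP[] := r01 h s a.
Qed.

(** [V h] is the value under [q] of the stages after [h], at most [H - 1] in number. One Bellman
    step splits the difference of values into [q - p] applied to that value, plus [p] applied to the
    difference one stage later. [V] does not depend on [s1], because the induction hypothesis is
    used at every next state. *)
Lemma simulation H (p q : transitions R S A H) pi (r : 'I_H -> S -> A -> R) :
  is_kernel p -> is_kernel q ->
  (forall h s a, 0 <= r h s a <= 1) ->
  exists V : 'I_H -> S -> R,
    (forall h s, 0 <= V h s <= H%:R - 1) /\
    forall s1, value q pi r s1 - value p pi r s1 =
      \sum_h \sum_s visit_prob p s1 (policy_of_det R pi) h s (pi h s) *
        \sum_s' (q h s (pi h s) s' - p h s (pi h s) s') * V h s'.
Proof.
elim: H p q pi r => [|H IH] p q pi r kp kq r01.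
  exists (fun _ _ => 0); split=> [[]//|s1].
  by rewrite /value !big_ord0 subrr.
have [V [Vb VE]] := IH _ _ (tail_stages pi) (tail_stages r) (tail_kernel kp)
  (tail_kernel kq) (fun h => r01 _).
pose W := value (tail_stages q) (tail_stages pi) (tail_stages r).
exists (fun h => oapp V W (unlift ord0 h)); split.
  move=> h s; rewrite -natr1 addrK; case: unliftP => [j|] _ /=.
    by have /andP[-> /le_trans->//] := Vb j s; rewrite gerDl lerN10.
  exact: value_bounds (tail_kernel kq) (fun h => r01 _).
move=> s1; rewrite big_ord_recl unlift_none /= !valueS // opprD addrACA subrr add0r.
rewrite [X in _ = X + _](bigD1 s1) //= [X in _ = (_ + X) + _]big1 ?addr0; last first.
  move=> s; rewrite eq_sym => /negbTE ns.
  rewrite (visit_prob_recl0 _ _ _ kp (is_policy_of_det pi)) ns.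
  by rewrite !mul0r.
rewrite (visit_prob_recl0 _ _ _ kp (is_policy_of_det pi)).
rewrite [policy_of_det _ _ _ _ _]/policy_of_det !eqxx !mul1r.
apply/eqP; rewrite [eqbRHS]addrC -subr_eq; apply/eqP.
(* Once the first-stage term in [q - p] has been moved to the left, the average under [p] of the
   later differences remains. *)
transitivity (\sum_s' p ord0 s1 (pi ord0 s1) s' *
  (W s' - value (tail_stages p) (tail_stages pi) (tail_stages r) s')).
  rewrite -!sumrB; apply: eq_bigr => s' _; rewrite /W; ring.
rewrite /W (eq_bigr _ (fun s' _ => congr1 _ (VE s'))).
under eq_bigr => s' _ do rewrite mulr_sumr.
rewrite exchange_big /=; apply: eq_bigr => h _.
under eq_bigr => s' _ do rewrite mulr_sumr.
rewrite exchange_big /=; apply: eq_bigr => s _.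
rewrite visit_prob_reclS sum_det mulr_suml liftK /=.
by apply: eq_bigr => s' _; rewrite mulrA.
Qed.

End Episodes.

(** * Deviation of adaptively collected episodes *)

Section UnionBounds.
Context (R : realType) d (T : measurableType d) (P : probability T R).

Lemma measure_fin_union (I : finType) (E : I -> set T) :
  (forall i, measurable (E i)) ->
  measurable (\bigcup_i E i) /\ (P (\bigcup_i E i) <= \sum_i P (E i))%E.
Proof.
move=> mE; rewrite (_ : \bigcup_i E i = \big[setU/set0]_i E i); last first.
  rewrite -bigcup_seq; apply: eq_bigcupl; split => i //= _.
  by rewrite mem_index_enum.
elim/big_rec2: _ => [|i A x _ [mA PA]]; first by rewrite measure0.
split; first exact: measurableU.
apply: le_trans (measureU2 P (mE i) mA) _.
exact: leeD2l.
Qed.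

(** The weights telescope: the first [n] of them sum to [1 - 1 / (n + 1)]. *)
Lemma measure_telescope_union (E : nat -> set T) (c : R) : 0 <= c ->
  (forall n, measurable (E n)) ->
  (forall n, P (E n) <= (c / (n.+1%:R * n.+2%:R))%:E)%E ->
  (P (\bigcup_n E n) <= c%:E)%E.
Proof.
move=> c0 mE PE.
apply: le_trans (generalized_Boole_inequality P mE (bigcupT_measurable _ mE)) _.
apply: lime_le; first by apply: is_cvg_nneseries => n _ _.
apply: nearW => n.
apply: (@le_trans _ _ (c * (1 - n.+1%:R^-1))%:E); last first.
  by rewrite lee_fin ler_piMr // gerBl invr_ge0 ler0n.
elim: n => [|n IH]; first by rewrite big_geq // invr1 subrr mulr0.
rewrite big_nat_recr //=.
apply: le_trans (leeD IH (PE n)) _; rewrite -EFinD lee_fin le_eqVlt.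
apply/orP; left; apply/eqP.
have n1 : n.+1%:R != 0 :> R by rewrite pnatr_eq0.
have n2 : n.+2%:R != 0 :> R by rewrite pnatr_eq0.
rewrite -[n.+2%:R]natr1 in n2 *; move: (n.+1%:R) n1 n2 => x x0 x1.
by field; rewrite x0 x1.
Qed.

End UnionBounds.

(** * Supermartingale property and Markov's inequality for products of episode weights *)

Section Supermartingale.
Context (R : realType) (S A : finType) (H : nat) (p : transitions R S A H)
  (s1 : S) d (Omega : measurableType d) (P : probability Omega R)
  (F : nat -> set (set Omega)) (pol : nat -> Omega -> policy R S A H)
  (X : nat -> Omega -> episode S A H).
Hypothesis p_kernel : is_kernel p.
Hypothesis sampling : adaptive_sampling P p s1 F pol X.

Lemma filtration_setI k B C : F k B -> F k C -> F k (B `&` C).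
Proof.
have Fk := filtration_sigma sampling k.
have [_ _ _ +] := (@sigma_algebraP _ setT (F k) (fun _ _ => @subsetT _ _)).1 Fk.
exact.
Qed.

Lemma measurable_episode_prob k e :
  measurable_fun setT (fun w => episode_prob p s1 (pol k w) e).
Proof.
apply: measurable_funM; first exact: measurable_cst.
apply: measurable_prod => h _; apply: measurable_funM; last exact: measurable_cst.
move=> _ Y mY; rewrite setTI; apply: (filtration_sub sampling (k := k)).
exact: policy_predictable sampling _ _ _ _ _ mY.
Qed.

Variable G : episode S A H -> R.
Hypothesis G_gt0 : forall e, 0 < G e.
Hypothesis G_le1 : forall pi, is_policy pi ->
  \sum_e episode_prob p s1 pi e * G e <= 1.

(** The one-step supermartingale inequality, tested on events of the past instead of through
    conditional expectations: [episode_law] turns the left-hand side into an integral over [B] whose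
    integrand is at most 1 by [G_le1]. *)
Lemma sum_step_le k B : F k B ->
  (\sum_e (G e)%:E * P (B `&` X k @^-1` [set e]) <= P B)%E.
Proof.
move=> FB; have mB := filtration_sub sampling FB.
have ep0 e w : 0 <= episode_prob p s1 (pol k w) e.
  by rewrite episode_prob_ge0 //; exact: policy_wf sampling _ _.
have mep e : measurable_fun B (EFin \o (fun w => episode_prob p s1 (pol k w) e)).
  apply/measurable_EFinP; apply: measurable_funS (measurable_episode_prob k e) => //.
have intE e : ((G e)%:E * P (B `&` X k @^-1` [set e]) =
    \int[P]_(w in B) ((G e)%:E * (episode_prob p s1 (pol k w) e)%:E))%E.
  rewrite (episode_law sampling) // ge0_integralZl_EFin //.
  - by move=> w _; rewrite lee_fin.
  - exact: mep.
  - exact: ltW.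
rewrite (eq_bigr _ (fun e _ => intE e)).
rewrite -ge0_integral_sum //.
- apply: (@le_trans _ _ (\int[P]_(w in B) cst 1 w)%E); last first.
    by rewrite integral_cst // mul1e.
  apply: ge0_le_integral => //.
  + by move=> w _; apply: sume_ge0 => e _; rewrite -EFinM lee_fin mulr_ge0 // ltW.
  + by apply: emeasurable_sum => e; exact: measurable_funeM (mep e).
  + move=> w _; under eq_bigr => e _ do rewrite -EFinM mulrC.
    by rewrite sumEFin lee_fin G_le1 //; exact: policy_wf sampling _ _.
- by move=> e; exact: measurable_funeM (mep e).
- by move=> e w _; rewrite -EFinM lee_fin mulr_ge0 // ltW.
Qed.

(* Markov's inequality for the supermartingale [\prod_(i < n) G (X i)],
   conditioned on the past of episode [k] so as to be proved by induction. *)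
Lemma prod_tail n k B c : 0 < c -> F k B ->
  let E := B `&` [set w | c <= \prod_(i < n) G (X (k + i)%N w)] in
  measurable E /\ (P E <= (c^-1)%:E * P B)%E.
Proof.
elim: n k B c => [|n IH] k B c c0 FB /=; have mB := filtration_sub sampling FB.
  under eq_set => w do rewrite big_ord0.
  have [c1|c1] := leP c 1.
    rewrite (_ : [set _ | _] = setT) ?setIT; last by apply/seteqP; split.
    split=> //; rewrite -[leLHS]mul1e lee_wpmul2r // lee_fin.
    by rewrite invf_ge1.
  rewrite (_ : [set _ | _] = set0) ?setI0; last by apply/seteqP; split.
  by rewrite measure0; split=> //; rewrite mule_ge0 // lee_fin invr_ge0 ltW.
have FX e : F k.+1 (B `&` X k @^-1` [set e]).
  apply: filtration_setI; first exact: filtration_mono sampling _ _ FB.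
  exact: episode_adapted sampling _ _.
(* On the event that episode [k] equals [e], the remaining product has to reach [c / G e]. There are
   finitely many [e], so the event splits into a finite union. *)
have IHe e := IH k.+1 _ (c / G e) (divr_gt0 c0 (G_gt0 e)) (FX e).
rewrite (_ : B `&` _ = \bigcup_e ((B `&` X k @^-1` [set e]) `&`
    [set w | c / G e <= \prod_(i < n) G (X (k.+1 + i)%N w)])); last first.
  have pE w : \prod_(i < n.+1) G (X (k + i)%N w) =
      G (X k w) * \prod_(i < n) G (X (k.+1 + i)%N w).
    rewrite big_ord_recl addn0; congr (_ * _).
    by apply: eq_bigr => i _; rewrite /bump /= addnS addSn.
  apply/seteqP; split=> w /=.
    move=> [Bw]; rewrite pE => cw; exists (X k w) => //; split => //=.
    by rewrite ler_pdivrMr // mulrC.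
  move=> [e _ [[Bw Xe]]] /=; rewrite ler_pdivrMr // mulrC => cw.
  by split=> //; rewrite pE Xe.
have [mU PU] := measure_fin_union P (fun e => (IHe e).1); split=> //.
apply: le_trans PU _.
apply: (@le_trans _ _ (\sum_e (c^-1)%:E * ((G e)%:E * P (B `&` X k @^-1` [set e])))%E).
  apply: lee_sum => e _; apply: le_trans (IHe e).2 _.
  by rewrite invf_div muleA -EFinM mulrC.
rewrite -ge0_sume_distrr; last first.
  by move=> e _; rewrite mule_ge0 // lee_fin ltW.
by rewrite lee_wpmul2l ?sum_step_le // lee_fin invr_ge0 ltW.
Qed.

Lemma prod_tail0 n c : 0 < c ->
  let E := [set w | c <= \prod_(i < n) G (X i w)] in
  measurable E /\ (P E <= (c^-1)%:E)%E.
Proof.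
move=> c0 /=.
have F0T : F 0 setT.
  have Fk := filtration_sigma sampling 0.
  by have [+ _ _ _] := (@sigma_algebraP _ setT (F 0) (fun _ _ => @subsetT _ _)).1 Fk.
by have := prod_tail n c0 F0T; rewrite /= setTI probability_setT mule1.
Qed.

End Supermartingale.

Lemma expectation_le_max (R : realType) (T : finType) (q U : T -> R) b :
  is_distr q -> (forall x, 0 <= U x <= b) -> 0 <= \sum_x q x * U x <= b.
Proof.
move=> [q0 q1] Ub; apply/andP; split.
  by apply: sumr_ge0 => x _; rewrite mulr_ge0 //; have /andP[] := Ub x.
rewrite -[leRHS]mul1r -q1 mulr_suml; apply: ler_sum => x _.
by rewrite ler_wpM2l //; have /andP[] := Ub x.
Qed.

Lemma natr_card_mkset (R : realType) (T : finType) (b : pred T) :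
  #|[set k : T | b k]|%:R = \sum_k (b k)%:R :> R.
Proof.
rewrite -sum1_card natr_sum big_mkcond /=; apply: eq_bigr => k _.
rewrite (_ : (k \in _) = b k); first by case: (b k).
by apply/idP/idP => [/set_mem //|/mem_set].
Qed.

(** * Exponential weights of an episode and their link with the empirical kernel *)

Section ExponentialWeights.
Variables (R : realType) (S A : finType) (H : nat) (p : transitions R S A H).
Hypothesis p_kernel : is_kernel p.
Variables (pi : det_policy S A H) (V lam : 'I_H -> S -> R).
Hypothesis V_bounds : forall h s, 0 <= V h s <= H%:R.

(** The quadratic term is Hoeffding's compensator for a centred variable bounded by [H]. The learner
    may play other policies, and actions that differ from [pi] get weight 1. *)
Definition step_exponent (h : 'I_H) (s : S) (a : A) (s' : S) : R :=
  (a == pi h s)%:R * (lam h s * (V h s' - \sum_s'' p h s a s'' * V h s'')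
                      - lam h s ^+ 2 * H%:R ^+ 2 / 2).

Definition episode_weight (e : episode S A H) : R :=
  \prod_h expR (step_exponent h (state_at e h) (action_at e h) (next_state_at e h)).

Lemma episode_weight_gt0 e : 0 < episode_weight e.
Proof. by apply: prodr_gt0 => h _; exact: expR_gt0. Qed.

Lemma episode_weight_le1 s1 pol : is_policy pol ->
  \sum_e episode_prob p s1 pol e * episode_weight e <= 1.
Proof.
move=> kpol; apply: (@expectation_prod_le1 R S A H p s1 pol
  (fun h s a s' => expR (step_exponent h s a s'))) => // h s a.
rewrite /step_exponent; case: eqP => _; last first.
  by under eq_bigr => s' _ do rewrite mul0r expR0 mulr1; rewrite (p_kernel h s a).2.
under eq_bigr => s' _ do rewrite mul1r expRD mulrA.
rewrite -mulr_suml -ler_pdivlMr ?expR_gt0 // expRN invrK mul1r.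
set m := \sum_s'' p h s a s'' * V h s''.
have mb : 0 <= m <= H%:R by exact: expectation_le_max (p_kernel h s a) (V_bounds h).
(* Tilting parameters may be negative, whereas Hoeffding's lemma takes a nonnegative bound. *)
have -> : lam h s ^+ 2 * H%:R ^+ 2 = (`|lam h s| * H%:R) ^+ 2.
  by rewrite exprMn real_normK // num_real.
apply: hoeffding_mgf_le => //.
- under eq_bigr => s' _ do rewrite mulrCA.
  rewrite -mulr_sumr; under eq_bigr => s' _ do rewrite mulrBr.
  by rewrite sumrB -mulr_suml (p_kernel h s a).2 mul1r subrr mulr0.
- move=> s'; rewrite normrM ler_wpM2l // ler_norml.
  by have := V_bounds h s'; lra.
Qed.

Lemma visit_countE (x : nat -> episode S A H) t h s a :
  (visit_count x t h s a)%:R =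
  \sum_(k < t) ((state_at (x k) h == s) && (action_at (x k) h == a))%:R :> R.
Proof. exact: natr_card_mkset. Qed.

Lemma sum_next_value (x : nat -> episode S A H) t q h s a (U : S -> R) :
  is_empirical_kernel x t q ->
  \sum_(k < t) ((state_at (x k) h == s) && (action_at (x k) h == a))%:R *
    U (next_state_at (x k) h) =
  (visit_count x t h s a)%:R * \sum_s' q h s a s' * U s'.
Proof.
move=> [_ qE]; have [n0|n_gt0] := posnP (visit_count x t h s a).
  (* At an unvisited triple all the indicators are 0, so both sides vanish whatever [q] is there. *)
  rewrite n0 mul0r; apply: big1 => k _.
  have := visit_countE x t h s a; rewrite n0 => /esym/eqP.
  rewrite psumr_eq0; last by move=> ? _; rewrite ler0n.
  by move=> /allP /(_ k (mem_index_enum _)) /= /eqP ->; rewrite mul0r.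
rewrite mulr_sumr; transitivity (\sum_s' \sum_(k < t)
   [&& state_at (x k) h == s, action_at (x k) h == a
                      & next_state_at (x k) h == s']%:R * U s').
  rewrite exchange_big /=; apply: eq_bigr => k _.
  rewrite (bigD1 (next_state_at (x k) h)) //= eqxx andbT [X in _ + X]big1 ?addr0 //.
  by move=> s'; rewrite eq_sym => /negbTE ->; rewrite !andbF mul0r.
apply: eq_bigr => s' _; rewrite qE // mulrA mulrCA mulfV ?pnatr_eq0 -?lt0n // mulr1.
by rewrite -mulr_suml; congr (_ * _); exact/esym/natr_card_mkset.
Qed.

(** Grouping the exponents by the state visited at each stage turns sums of next-state values into
    counts times empirical means. The exponent then has the form handled by [deviation_of_tilts]. *)
Lemma prod_episode_weight (x : nat -> episode S A H) t q :
  is_empirical_kernel x t q ->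
  \prod_(k < t) episode_weight (x k) =
  expR (\sum_h \sum_s
    (lam h s * ((visit_count x t h s (pi h s))%:R *
        \sum_s' (q h s (pi h s) s' - p h s (pi h s) s') * V h s')
     - (visit_count x t h s (pi h s))%:R * (lam h s ^+ 2 * H%:R ^+ 2 / 2))).
Proof.
move=> qE; rewrite /episode_weight.
under eq_bigr => k _ do rewrite -expR_sum.
rewrite -expR_sum exchange_big /=; congr expR; apply: eq_bigr => h _.
transitivity (\sum_(k < t) \sum_s
    ((state_at (x k) h == s) && (action_at (x k) h == pi h s))%:R *
    (lam h s * (V h (next_state_at (x k) h)
       - \sum_s'' p h s (pi h s) s'' * V h s'') - lam h s ^+ 2 * H%:R ^+ 2 / 2)).
  apply: eq_bigr => k _; rewrite (bigD1 (state_at (x k) h)) //= eqxx /=.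
  rewrite [X in _ = _ + X]big1 ?addr0.
    rewrite /step_exponent; case: eqP => [->//|_]; by rewrite !mul0r.
  by move=> s; rewrite eq_sym => /negbTE ->; rewrite mul0r.
rewrite exchange_big /=; apply: eq_bigr => s _.
under [X in _ = _ * (_ * X) - _]eq_bigr => s' _ do rewrite mulrBl.
rewrite sumrB mulrBr -sum_next_value // visit_countE.
set m := \sum_s'' p h s _ s'' * V h s''; set c := _ / 2.
under eq_bigr => k _ do
  rewrite mulrBr mulrBr [X in X - _]mulrBr [X in X - _ - _]mulrCA [X in _ - X - _]mulrCA.
by rewrite !sumrB -!mulr_sumr -!mulr_suml mulrBr.
Qed.

End ExponentialWeights.

(** * Cauchy-Schwarz inequality and choice of the tilting parameters *)

Section Optimisation.
Variables (R : realType) (I : finType) (Q : pred I) (w n : I -> R).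
Hypothesis n_gt0 : forall i, Q i -> 0 < n i.

Definition weighted_squares : R := \sum_(i | Q i) w i ^+ 2 / n i.
Local Notation W := weighted_squares.

Lemma weighted_squares_ge0 : 0 <= W.
Proof.
by apply: sumr_ge0 => i Qi; rewrite divr_ge0 ?sqr_ge0 // ltW // n_gt0.
Qed.

(** The sum of [(w i - c * n i) ^+ 2 / n i] is nonnegative for every [c]; the choice [c = B / N]
    gives the claim. If [N = 0] then [Q] is empty, as [n] is positive on it. *)
Lemma cauchy_schwarz_weighted :
  (\sum_(i | Q i) w i) ^+ 2 <= W * \sum_(i | Q i) n i.
Proof.
set B := \sum_(i | Q i) w i; set N := \sum_(i | Q i) n i.
have N0 : 0 <= N by apply: sumr_ge0 => i Qi; rewrite ltW // n_gt0.
have key c : 0 <= W - 2 * c * B + c ^+ 2 * N.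
  rewrite /weighted_squares /B /N !mulr_sumr -sumrB -big_split /=; apply: sumr_ge0 => i Qi.
  have ni := n_gt0 Qi.
  rewrite (_ : _ + _ = (w i - c * n i) ^+ 2 / n i); last by field; lra.
  by rewrite divr_ge0 ?sqr_ge0 // ltW.
have [N_eq0|N_neq0] := eqVneq N 0.
  have Q0 i : Q i -> False.
    move=> Qi; move/eqP: N_eq0; rewrite psumr_eq0 => [|j Qj]; last by rewrite ltW // n_gt0.
    move=> /allP /(_ i (mem_index_enum _)) /implyP /(_ Qi) /eqP ni.
    by have := n_gt0 Qi; rewrite ni ltxx.
  rewrite N_eq0 mulr0 /B big1 ?expr0n // => i Qi; by case: (Q0 i Qi).
have N_gt0 : 0 < N by rewrite lt_neqAle eq_sym N_neq0.
have := key (B / N).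
rewrite (_ : _ + _ = W - B ^+ 2 / N); last by field.
by rewrite subr_ge0 ler_pdivrMr.
Qed.

Variables (D : I -> R) (H L : R).
Hypotheses (H_gt0 : 0 < H) (L_gt0 : 0 < L).

Definition tilt_scale : R := 2 * L / Num.sqrt (2 * L * H ^+ 2 * W).

(* Minimises [L / c + c H^2 W / 2], the deviation bound obtained at
   tilting parameters [c w / n]. *)
Definition tilt (sg : bool) (i : I) : R :=
  if Q i then (-1) ^+ sg * (tilt_scale * (w i / n i)) else 0.

(** With [c] the scale and [Y] the deviation, the hypothesis reads [c Y - c^2 H^2 W / 2 <= L] up to
    the sign of [Y]. The scale makes the quadratic term equal to [L], so [Y <= 2 L / c], which is
    the square root. The two signs give the absolute value. *)
Lemma deviation_of_tilts :
  (forall sg, \sum_i (tilt sg i * (n i * D i)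
     - n i * (tilt sg i ^+ 2 * H ^+ 2 / 2)) <= L) ->
  `| \sum_(i | Q i) w i * D i | <= Num.sqrt (2 * L * H ^+ 2 * W).
Proof.
move=> tiltL; set Y := \sum_(i | Q i) _; set a := Num.sqrt _.
(* If [W = 0], all the weights vanish on [Q], and [tilt_scale] is a division by 0. *)
have [W0|W_neq0] := eqVneq W 0.
  rewrite /Y big1 ?normr0 ?sqrtr_ge0 // => i Qi.
  move/eqP: W0; rewrite /weighted_squares psumr_eq0 => [|j Qj].
    move=> /allP /(_ i (mem_index_enum _)) /implyP /(_ Qi).
    by rewrite mulf_eq0 invr_eq0 (gt_eqF (n_gt0 Qi)) orbF sqrf_eq0 => /eqP ->; rewrite mul0r.
  by rewrite divr_ge0 ?sqr_ge0 // ltW // n_gt0.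
have W_gt0 : 0 < W by rewrite lt_neqAle eq_sym W_neq0 weighted_squares_ge0.
have rad_gt0 : 0 < 2 * L * H ^+ 2 * W by rewrite !mulr_gt0 // exprn_gt0.
have a_gt0 : 0 < a by rewrite sqrtr_gt0.
have a2 : a ^+ 2 = 2 * L * H ^+ 2 * W by rewrite sqr_sqrtr // ltW.
have tiltE sg : \sum_i (tilt sg i * (n i * D i) - n i * (tilt sg i ^+ 2 * H ^+ 2 / 2)) =
    (-1) ^+ sg * tilt_scale * Y - tilt_scale ^+ 2 * H ^+ 2 / 2 * W.
  rewrite /Y /weighted_squares !mulr_sumr -sumrB [RHS]big_mkcond /=; apply: eq_bigr => i _.
  rewrite /tilt; case: ifP => Qi; last by rewrite mul0r expr0n /= !mul0r mulr0 subrr.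
  rewrite exprMn sqrr_sign mul1r.
  by field; rewrite gt_eqF // n_gt0.
have scale2 : tilt_scale ^+ 2 * H ^+ 2 / 2 * W = L.
  rewrite /tilt_scale -/a expr_div_n a2; field.
  by rewrite W_neq0 (gt_eqF H_gt0) (gt_eqF L_gt0).
have scale_gt0 : 0 < tilt_scale by rewrite divr_gt0 // mulr_gt0.
have bound y : tilt_scale * y - L <= L -> y <= a.
  rewrite lerBlDr -ler_pdivlMl // (_ : _^-1 * _ = a) // /tilt_scale -/a.
  by field; rewrite (gt_eqF a_gt0) (gt_eqF L_gt0).
rewrite ler_norml; apply/andP; split.
  rewrite lerNl; apply: bound; have := tiltL true.
  by rewrite tiltE scale2 expr1 mulN1r mulNr mulrN.
by apply: bound; have := tiltL false; rewrite tiltE scale2 expr0 mul1r.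
Qed.

End Optimisation.

(** * Union bound and the good event *)

Section Concentration.
Variables (R : realType) (S A : finType) (H : nat) (p : transitions R S A H)
  (s1 : S) (Z : {set 'I_H * S * A}).
Hypothesis p_kernel : is_kernel p.

Definition on_Z (pi : det_policy S A H) (z : 'I_H * S) : bool :=
  (z, pi z.1 z.2) \in Z.

Definition reach (pi : det_policy S A H) (z : 'I_H * S) : R :=
  visit_prob p s1 (policy_of_det R pi) z.1 z.2 (pi z.1 z.2).

(* A sign, a policy, a vector of counts and a rounded value function. *)
Definition tilt_index (t : nat) : finType :=
  (bool * {ffun 'I_H * S -> A * 'I_t.+1 * 'I_t.+1})%type.

Definition index_policy t (i : tilt_index t) : det_policy S A H :=
  fun h s => (i.2 (h, s)).1.1.

Definition index_count t (i : tilt_index t) (z : 'I_H * S) : R :=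
  (i.2 z).1.2%:R.

Definition index_value t (i : tilt_index t) (h : 'I_H) (s : S) : R :=
  H%:R / t.+1%:R * (i.2 (h, s)).2%:R.

Definition index_tilt (L : R) t (i : tilt_index t) (h : 'I_H) (s : S) : R :=
  tilt (on_Z (index_policy i)) (reach (index_policy i)) (index_count i)
    H%:R L i.1 (h, s).

(** The inverse of the failure probability allotted to one index at time [t]: [delta] is shared
    among times with telescoping weights [1 / (t (t + 1))], then equally among the indices. *)
Definition threshold (delta : R) (t : nat) : R :=
  #|tilt_index t|%:R * (t%:R * t.+1%:R) / delta.

(** The tilts are tuned to the logarithm of the very threshold that the product has to cross. *)
Definition bad_event (delta : R) (Omega : Type) (X : nat -> Omega -> episode S A H)
    (t : nat) : set Omega :=
  \bigcup_(i : tilt_index t)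
    [set w | threshold delta t <= \prod_(k < t)
       episode_weight p (index_policy i) (index_value i)
         (index_tilt (ln (threshold delta t)) i) (X k w)].

Lemma index_value_bounds t (i : tilt_index t) h s :
  0 <= index_value i h s <= H%:R.
Proof.
rewrite /index_value; apply/andP; split; first by rewrite mulr_ge0 ?divr_ge0.
rewrite mulrAC ler_pdivrMr ?ltr0n // ler_wpM2l // ler_nat ltnW //.
Qed.

(** Markov's inequality for each index, then a union over the indices. Times start at 1 because the
    threshold is 0 at time 0. *)
Lemma bad_event_le (delta : R) d (Omega : measurableType d)
    (P : probability Omega R) F pol (X : nat -> Omega -> episode S A H) t :
  adaptive_sampling P p s1 F pol X -> 0 < delta ->
  measurable (bad_event delta X t.+1) /\
  (P (bad_event delta X t.+1) <= (delta / (t.+1%:R * t.+2%:R))%:E)%E.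
Proof.
move=> sampling delta0; set c := threshold delta t.+1.
have tail (i : tilt_index t.+1) : let E := [set w | c <= \prod_(k < t.+1)
       episode_weight p (index_policy i) (index_value i)
         (index_tilt (ln c) i) (X k w)] in
    measurable E /\ (P E <= (c^-1)%:E)%E.
  apply: (prod_tail0 p_kernel sampling).
  - by move=> e; exact: episode_weight_gt0.
  - by move=> pol' kpol'; apply: episode_weight_le1 => //; exact: index_value_bounds.
  - rewrite /c /threshold divr_gt0 // !mulr_gt0 // ltr0n.
    by apply/card_gt0P; exists i.
have [mU PU] := measure_fin_union P (fun i => (tail i).1); split=> //.
apply: le_trans PU _; apply: le_trans (lee_sum _ (fun i _ => (tail i).2)) _.
rewrite sumEFin lee_fin sumr_const -[leLHS]mulr_natr /c /threshold.
rewrite (_ : #|xpredT| = #|tilt_index t.+1|); last exact: eq_card.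
have [->|card0] := eqVneq #|tilt_index t.+1| 0%N.
  by rewrite mulr0 divr_ge0 ?mulr_ge0 // ltW.
rewrite le_eqVlt; apply/orP; left; apply/eqP.
have n1 : t.+1%:R != 0 :> R by rewrite pnatr_eq0.
have n2 : t.+2%:R != 0 :> R by rewrite pnatr_eq0.
move: (t.+1%:R) (t.+2%:R) n1 n2 => x y x0 y0; field.
by rewrite pnatr_eq0 card0 (gt_eqF delta0) x0 y0.
Qed.

End Concentration.

(** * Comparison of the log-cardinality with [beta_RF] *)

Section Assembly.
Variables (R : realType) (S A : finType) (H : nat).

Lemma card_tilt_index t :
  #|tilt_index S A H t| = (2 * (#|A| * t.+1 * t.+1) ^ (H * #|S|))%N.
Proof.
by rewrite card_prod card_bool card_ffun !card_prod !card_ord.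
Qed.

(** This is [1 + x <= expR x] at [x = - 1/2]. *)
Lemma ln2_ge_half : 2^-1 <= ln 2 :> R.
Proof.
rewrite -[leLHS]expRK ler_ln ?posrE ?expR_gt0 //.
have := expR_ge1Dx (- 2^-1 : R); rewrite expRN.
rewrite (_ : 1 + - 2^-1 = 2^-1 :> R); last by field.
by rewrite lef_pV2 ?posrE ?expR_gt0.
Qed.

Lemma threshold_gt0 (delta : R) t : (0 < t)%N -> (0 < #|A|)%N ->
  0 < delta -> 0 < threshold S A H delta t.
Proof.
move=> t0 A0 d0; rewrite /threshold divr_gt0 // -!natrM ltr0n card_tilt_index.
by rewrite !muln_gt0 expn_gt0 !muln_gt0 A0 t0.
Qed.

Lemma ln_threshold_gt0 (delta : R) t : (0 < t)%N -> (0 < #|A|)%N ->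
  0 < delta < 1 -> 0 < ln (threshold S A H delta t).
Proof.
move=> t0 A0 /andP[d0 d1]; apply: ln_gt0.
rewrite /threshold ltr_pdivlMr // mul1r (lt_le_trans d1) //.
rewrite -natrM -natrM ler1n !muln_gt0 t0 /= andbT card_tilt_index.
by rewrite muln_gt0 expn_gt0 !muln_gt0 A0.
Qed.

(** The left-hand side collects the squared contributions of concentration and of rounding, each
    doubled by [(a + b)^2 <= 2 a^2 + 2 b^2]. *)
Lemma beta_RF_ge (delta : R) t : (0 < t)%N -> (0 < H)%N ->
    (0 < #|S|)%N -> (0 < #|A|)%N -> 0 < delta < 1 ->
  2 * (2 * ln (threshold S A H delta t) * H%:R ^+ 2) + 2 * H%:R ^+ 3 <=
  beta_RF #|S| #|A| H t delta.
Proof.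
move=> t0 H0 S0 A0 /andP[d0 d1]; rewrite /beta_RF.
rewrite (_ : 1 + t%:R = t.+1%:R); last by rewrite addrC natr1.
set l := ln (t.+1%:R : R); set a := ln (#|A|%:R : R).
have t1_gt0 : 0 < t.+1%:R :> R by rewrite ltr0n.
have A_gt0 : 0 < #|A|%:R :> R by rewrite ltr0n.
have l2 : 2^-1 <= l.
  by rewrite (le_trans ln2_ge_half) // ler_ln ?posrE // ler_nat.
have a0 : 0 <= a by rewrite ln_ge0 // ler1n.
rewrite lnM ?posrE // -/a -/l.
(* The factors 2 (for the sign), [t] and [t + 1] are each at most [t + 1], hence [3 * l]. Each of
   the [H S] coordinates of an index takes [A (t + 1)^2] values. *)
have Lle : ln (threshold S A H delta t) <=
    ln (1 / delta) + 3 * l + (H * #|S|)%:R * (a + 2 * l).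
  have -> : 3 * l = ln (t.+1%:R ^+ 3) by rewrite lnXn // mulr_natl.
  have -> : (H * #|S|)%:R * (a + 2 * l) =
      ln ((#|A|%:R * t.+1%:R ^+ 2) ^+ (H * #|S|) : R).
    rewrite lnXn ?mulr_gt0 ?exprn_gt0 // lnM ?posrE ?exprn_gt0 //.
    by rewrite lnXn // -[RHS]mulr_natl -[ln _ *+ 2]mulr_natl.
  have thr_gt0 := threshold_gt0 t0 A0 d0.
  have pow_gt0 : 0 < (#|A|%:R * t.+1%:R ^+ 2) ^+ (H * #|S|) :> R.
    by rewrite exprn_gt0 // mulr_gt0 ?exprn_gt0.
  have dinv_gt0 : 0 < 1 / delta by rewrite divr_gt0.
  have t3_gt0 : 0 < t.+1%:R ^+ 3 :> R by rewrite exprn_gt0.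
  have dt_gt0 := mulr_gt0 dinv_gt0 t3_gt0.
  have dtp_gt0 := mulr_gt0 dt_gt0 pow_gt0.
  rewrite -[X in X + _]lnM ?posrE // -lnM ?posrE // ler_ln ?posrE //.
  rewrite /threshold card_tilt_index natrM natrX.
  have -> : (#|A| * t.+1 * t.+1)%:R = #|A|%:R * t.+1%:R ^+ 2 :> R.
    by rewrite !natrM -mulrA -expr2.
  move: (_ ^+ (H * #|S|)) pow_gt0 => Q Q_gt0.
  rewrite [leRHS](_ : _ = t.+1%:R * Q * (t.+1%:R * t.+1%:R) / delta); last first.
    by rewrite mul1r; ring.
  rewrite ler_wpM2r ?invr_ge0 ?(ltW d0) // ler_pM ?mulr_ge0 ?(ltW Q_gt0) //.
    by rewrite ler_wpM2r ?(ltW Q_gt0) // ler_nat.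
  by rewrite ler_wpM2r // ler_nat.
have S1 : 1 <= #|S|%:R :> R by rewrite ler1n.
have H1 : 1 <= H%:R :> R by rewrite ler1n.
move: Lle l2 a0; rewrite natrM.
move: (ln (threshold _ _ _ _ _)) (ln (1 / delta)) => L dl.
clearbody l a; move: (#|S|%:R) (H%:R) S1 H1 => s h s1 h1 Lle l2 a0.
(* The constant 24 arises here: [12 l + 8 h s l + 2 h] is at most [(12 + 8 + 4) h s l], by
   [1 <= h s] and [1/2 <= s l]. *)
have hs : 1 <= h * s by rewrite mulr_ege1.
have sl : 2^-1 <= s * l by rewrite (le_trans l2) // ler_peMl //; lra.
have l_hsl : l <= h * s * l by rewrite ler_peMl //; lra.
have h_hsl : h * 2^-1 <= h * (s * l) by rewrite ler_wpM2l //; lra.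
have hsa : 0 <= h * s * a by rewrite !mulr_ge0 //; lra.
rewrite (_ : 2 * (2 * L * h ^+ 2) + 2 * h ^+ 3 = h ^+ 2 * (4 * L + 2 * h)); last by ring.
rewrite (_ : _ + _ * (a + l) = h ^+ 2 * (4 * dl + 24 * (h * s) * (a + l))); last by ring.
rewrite ler_wpM2l ?sqr_ge0 //; lra.
Qed.

End Assembly.

(** * Deviation bound on the good event, for a fixed realisation *)

Section GoodEvent.
Variables (R : realType) (S A : finType) (H : nat) (p q : transitions R S A H)
  (s1 : S) (Z : {set 'I_H * S * A}) (x : nat -> episode S A H) (t : nat)
  (delta : R) (pi : det_policy S A H).
Hypotheses (p_kernel : is_kernel p) (q_empirical : is_empirical_kernel x t q).

Let n (z : 'I_H * S) : nat := visit_count x t z.1 z.2 (pi z.1 z.2).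

Lemma sum_visit_count_le : \sum_z (n z)%:R <= (H * t)%:R :> R.
Proof.
rewrite /n; under eq_bigr => z _ do rewrite visit_countE.
rewrite -(pair_big xpredT xpredT (fun h s => \sum_(k < t)
  ((state_at (x k) h == s) && (action_at (x k) h == pi h s))%:R)) /=.
rewrite [leRHS](_ : _ = \sum_(h < H) \sum_(k < t) 1); last first.
  by rewrite !sumr_const !card_ord mulnC mulrnA.
apply: ler_sum => h _; rewrite exchange_big /=; apply: ler_sum => k _.
rewrite (bigD1 (state_at (x k) h)) //= [X in _ + X]big1 ?addr0.
  by case: (_ && _).
by move=> s; rewrite eq_sym => /negbTE ->.
Qed.

Lemma visit_count_le h s a : (visit_count x t h s a <= t)%N.
Proof. by rewrite -[leqRHS]card_ord; exact: max_card. Qed.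

(** Both means lie in the interval from 0 to [b], so they differ by at most [b], with no factor
    2. *)
Lemma kernel_diff_le (U : S -> R) (b : R) h s a :
  (forall s', 0 <= U s' <= b) ->
  `| \sum_s' (q h s a s' - p h s a s') * U s' | <= b.
Proof.
move=> Ub; under eq_bigr => s' _ do rewrite mulrBl.
have := expectation_le_max (p_kernel h s a) Ub.
have := expectation_le_max (q_empirical.1 h s a) Ub.
by rewrite sumrB ler_norml; lra.
Qed.

Hypotheses (t_gt0 : (0 < t)%N) (H_gt0 : (0 < H)%N) (delta01 : 0 < delta < 1).
Hypothesis good : forall i : tilt_index S A H t,
  \prod_(k < t) episode_weight p (index_policy i) (index_value R i)
    (index_tilt p s1 Z (ln (threshold S A H delta t)) i) (x k)
  < threshold S A H delta t.
Hypothesis visited : forall z, on_Z Z pi z -> (0 < n z)%N.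
Variable V : 'I_H -> S -> R.
Hypothesis V_bounds : forall h s, 0 <= V h s <= H%:R - 1.

Let w := reach p s1 pi.
Let D (U : 'I_H -> S -> R) (z : 'I_H * S) : R :=
  \sum_s' (q z.1 z.2 (pi z.1 z.2) s' - p z.1 z.2 (pi z.1 z.2) s') * U z.1 s'.
Let W := weighted_squares (on_Z Z pi) w (fun z => (n z)%:R).
Let L := ln (threshold S A H delta t).

Let round (z : 'I_H * S) : 'I_t.+1 := inord (Num.truncn (V z.1 z.2 * t.+1%:R / H%:R)).

(** The index realised by the data. Counts and rounded values may depend on the observations because
    [good] covers all indices. *)
Let index (sg : bool) : tilt_index S A H t :=
  (sg, [ffun z => (pi z.1 z.2, inord (n z), round z)]).

Let Hr_gt0 : 0 < H%:R :> R. Proof. by rewrite ltr0n. Qed.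
Let t1_gt0 : 0 < t.+1%:R :> R. Proof. by rewrite ltr0n. Qed.

Let A_gt0 : (0 < #|A|)%N.
Proof. by apply/card_gt0P; exists (pi (Ordinal H_gt0) s1). Qed.

Let S_gt0 : (0 < #|S|)%N.
Proof. by apply/card_gt0P; exists s1. Qed.

Let round_le h s : H%:R / t.+1%:R * (round (h, s))%:R <= V h s <
  H%:R / t.+1%:R * (round (h, s))%:R + H%:R / t.+1%:R.
Proof.
have /andP[V0 V1] := V_bounds h s; rewrite /round /=.
set y := V h s * t.+1%:R / H%:R.
have y0 : 0 <= y by rewrite divr_ge0 ?mulr_ge0.
have /andP[y1 y2] := truncn_itv y0.
(* [inord] is faithful only below [t + 1]; this is guaranteed by [V <= H - 1 < H]. *)
rewrite inordK; last first.
  rewrite -(ltr_nat R); apply: le_lt_trans y1 _.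
  by rewrite ltr_pdivrMr // mulrC ltr_pM2l //; lra.
have -> : V h s = H%:R / t.+1%:R * y.
  by rewrite /y; field; rewrite !gt_eqF.
have c0 : 0 < H%:R / t.+1%:R :> R by rewrite divr_gt0.
rewrite ler_wpM2l ?(ltW c0) //= -{3}[H%:R / _]mulr1 -mulrDr natr1.
by rewrite ltr_pM2l.
Qed.

Let index_policyE sg : index_policy (index sg) = pi.
Proof. by apply/funext => h; apply/funext => s; rewrite /index_policy ffunE. Qed.

Let index_countE sg : index_count R (index sg) = (fun z => (n z)%:R).
Proof.
apply/funext => z; rewrite /index_count ffunE /= inordK // ltnS.
exact: visit_count_le.
Qed.

Let V' : 'I_H -> S -> R := fun h s => H%:R / t.+1%:R * (round (h, s))%:R.

Let index_valueE sg : index_value R (index sg) = V'.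
Proof.
by apply/funext => h; apply/funext => s; rewrite /index_value ffunE.
Qed.

Let rounded_deviation :
  `| \sum_(z | on_Z Z pi z) w z * D V' z | <= Num.sqrt (2 * L * H%:R ^+ 2 * W).
Proof.
have L_gt0 : 0 < L by exact: ln_threshold_gt0.
apply: deviation_of_tilts => //; first by move=> z zZ; rewrite ltr0n visited.
move=> sg; have := good (index sg).
rewrite (prod_episode_weight _ _ _ _ q_empirical) index_policyE index_valueE.
rewrite -[ltRHS]lnK ?posrE ?threshold_gt0 //; last by case/andP: delta01.
rewrite ltr_expR => /ltW; apply: le_trans; rewrite pair_big /=.
rewrite le_eqVlt; apply/orP; left; apply/eqP; apply: eq_bigr => -[h s] _ /=.
by rewrite /index_tilt index_policyE index_countE.
Qed.

(** Rounding [V] down to [V'] costs at most the mesh [e] times the sum of the [w z]. By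
    Cauchy-Schwarz and the bound [H t] on the total count, this is at most the square root of
    [e^2 H t W], hence of [H^3 W]. *)
Lemma good_event_deviation :
  `| \sum_(z | on_Z Z pi z) w z * D V z | <=
  Num.sqrt (beta_RF #|S| #|A| H t delta *
    \sum_(z | on_Z Z pi z) w z ^+ 2 / (n z)%:R).
Proof.
rewrite -/(weighted_squares _ _ _) -/W.
have w0 z : 0 <= w z by rewrite visit_prob_ge0 //; exact: is_policy_of_det.
have n0 z : on_Z Z pi z -> 0 < (n z)%:R :> R by move=> /visited; rewrite ltr0n.
have W0 : 0 <= W by exact: weighted_squares_ge0.
have L_gt0 : 0 < L by exact: ln_threshold_gt0.
pose e : R := H%:R / t.+1%:R.
have e0 : 0 <= e by rewrite divr_ge0.
have split_le : `| \sum_(z | on_Z Z pi z) w z * D V z | <=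
    `| \sum_(z | on_Z Z pi z) w z * D V' z | + e * \sum_(z | on_Z Z pi z) w z.
  rewrite -lerBlDl (le_trans (lerB_dist _ _)) // -sumrB mulr_sumr.
  apply: le_trans (ler_norm_sum _ _ _) _; apply: ler_sum => z _.
  rewrite -mulrBr normrM (ger0_norm (w0 z)) mulrC ler_wpM2r //.
  rewrite /D -sumrB; under eq_bigr => s' _ do rewrite -mulrBr.
  apply: (kernel_diff_le (U := fun s' => V z.1 s' - V' z.1 s')) => s'.
  have /andP[r1 r2] := round_le z.1 s'.
  by rewrite subr_ge0 r1 lerBlDl ltW.
apply: le_trans split_le _.
apply: (@le_trans _ _ (Num.sqrt (2 * L * H%:R ^+ 2 * W) + Num.sqrt (H%:R ^+ 3 * W))).
  apply: lerD rounded_deviation _.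
  have B0 : 0 <= \sum_(z | on_Z Z pi z) w z by apply: sumr_ge0.
  rewrite -[leLHS]ger0_norm ?mulr_ge0 // -sqrtr_sqr ler_wsqrtr // exprMn.
  apply: le_trans (ler_wpM2l (sqr_ge0 e) (cauchy_schwarz_weighted w n0)) _.
  rewrite -/W mulrCA mulrC ler_wpM2r //.
  apply: (@le_trans _ _ (e ^+ 2 * (H * t)%:R)).
    rewrite ler_wpM2l ?sqr_ge0 //; apply: le_trans sum_visit_count_le.
    by rewrite [leRHS](bigID (on_Z Z pi)) /= lerDl sumr_ge0.
  rewrite /e expr_div_n natrM mulrAC ler_pdivrMr ?exprn_gt0 //.
  rewrite exprSr -!mulrA ler_wpM2l ?sqr_ge0 // ler_wpM2l //.
  by rewrite ler_wpM2l // -natrX ler_nat (leq_trans (leqnSn t)) //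
    -{1}[t.+1]muln1 expnS leq_mul.
have beta_ge := beta_RF_ge t_gt0 H_gt0 S_gt0 A_gt0 delta01.
set a := Num.sqrt (_ * _ * _ * _); set b := Num.sqrt (_ * W).
have a0 : 0 <= a by exact: sqrtr_ge0.
have b0 : 0 <= b by exact: sqrtr_ge0.
rewrite -[leLHS]ger0_norm ?addr_ge0 // -sqrtr_sqr ler_wsqrtr //.
(* Merges the two square roots into one, at the price of the factor 2 absorbed in [beta_RF]. *)
apply: (@le_trans _ _ (2 * a ^+ 2 + 2 * b ^+ 2)).
  by have := sqr_ge0 (a - b); rewrite !expr2; lra.
rewrite /a /b !sqr_sqrtr ?mulr_ge0 ?exprn_ge0 ?(ltW L_gt0) //.
rewrite (_ : _ + _ = (2 * (2 * L * H%:R ^+ 2) + 2 * H%:R ^+ 3) * W); last by ring.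
by rewrite ler_wpM2r.
Qed.

End GoodEvent.

(** * Cover time and sums over the pairs selected by a policy *)

Section Cover.
Variables (R : realType) (S A : finType) (H : nat).

Lemma visit_count_mono (x : nat -> episode S A H) u t h s a :
  (u <= t)%N -> (visit_count x u h s a <= visit_count x t h s a)%N.
Proof.
move=> ut; rewrite -(ler_nat R) !visit_countE.
rewrite (big_ord_widen t (fun k => ((state_at (x k) h == s) &&
  (action_at (x k) h == a))%:R)) //.
by rewrite [leRHS](bigID (fun k : 'I_t => (k < u)%N)) /= lerDl sumr_ge0.
Qed.

Lemma cover_time_visited (x : nat -> episode S A H) (Z : {set 'I_H * S * A}) t :
  (cover_time R x Z <= t%:R%:E)%E ->
  forall h s a, (h, s, a) \in Z -> (0 < visit_count x t h s a)%N.
Proof.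
move=> xt h s a zZ.
(* A strict bound on the infimum yields a covering time [u < t + 1], that is [u <= t]. *)
have /ereal_inf_lt [_ [u uZ <-]] : (cover_time R x Z < t.+1%:R%:E)%E.
  by apply: le_lt_trans xt _; rewrite lte_fin ltr_nat.
rewrite lte_fin ltr_nat ltnS => /(@visit_count_mono x _ _ h s a).
by apply: leq_trans; exact: uZ.
Qed.

Lemma on_policy_cardE (Z : {set 'I_H * S * A}) (pi : det_policy S A H) :
  on_policy_card Z pi = #|[pred z | on_Z Z pi z]|.
Proof.
pose g (z : 'I_H * S) := (z, pi z.1 z.2).
have g_inj : injective g by move=> y z [].
rewrite /on_policy_card -(fintype.card_image g_inj); apply: eq_card => z.
rewrite inE; apply/andP/fintype.imageP => [[zZ /imset2P[h s _ _ zE]]|[y yZ ->]].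
  by exists (h, s) => //; rewrite /in_mem /= /on_Z /= -zE.
split=> //; apply/imset2P; exists y.1 y.2 => //.
by rewrite /g; case: y {yZ}.
Qed.

Lemma sum_on_Z_le (Z : {set 'I_H * S * A}) (pi : det_policy S A H)
    (f : 'I_H * S * A -> R) :
  (forall z, 0 <= f z) ->
  \sum_(z | on_Z Z pi z) f (z, pi z.1 z.2) <= \sum_(z in Z) f z.
Proof.
move=> f0.
rewrite (eq_bigl (fun z => true && ((z.1, z.2) \in Z))); last by case.
rewrite (eq_bigr (fun z => f (z.1, z.2))); last by case.
rewrite -(pair_big_dep xpredT (fun y a => (y, a) \in Z) (fun y a => f (y, a))) /=.
rewrite big_mkcond /=; apply: ler_sum => y _; case: ifP => yZ.
  by rewrite (bigD1 (pi y.1 y.2)) //= lerDl sumr_ge0.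
exact: sumr_ge0.
Qed.

End Cover.

Theorem theorem27 (R : realType) (S A : finType) (H : nat)
    (p : transitions R S A H) (s1 : S)
    (d : measure_display) (Omega : measurableType d) (P : probability Omega R)
    (F : nat -> set (set Omega))
    (pol : nat -> Omega -> policy R S A H)
    (X : nat -> Omega -> episode S A H)
    (phat : nat -> Omega -> transitions R S A H)
    (Z : {set 'I_H * S * A}) (eps0 delta : R)
    (p_kernel : is_kernel p)
    (sampling : adaptive_sampling P p s1 F pol X)
    (phat_empirical : forall t w,
      is_empirical_kernel (fun k => X k w) t (phat t w))
    (eps0_gt0 : 0 < eps0)
    (outside_Z : forall h s a, (h, s, a) \notin Z ->
      forall pi : det_policy S A H,
        visit_prob p s1 (policy_of_det R pi) h s a <= eps0)
    (delta_gt0 : 0 < delta) (delta_lt1 : delta < 1) :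
  exists E : set Omega,
    [/\ measurable E,
        ((1 - delta)%:E <= P E)%E &
        forall w, E w ->
        forall t : nat, (cover_time R (fun k => X k w) Z <= t%:R%:E)%E ->
        forall (pi : det_policy S A H) (r : 'I_H -> S -> A -> R),
          (forall h s a, 0 <= r h s a <= 1) ->
          `| \sum_(h < H) \sum_(s : S) \sum_(a : A)
               (visit_prob (phat t w) s1 (policy_of_det R pi) h s a
                - visit_prob p s1 (policy_of_det R pi) h s a) * r h s a |
          <= Num.sqrt
               (beta_RF #|S| #|A| H t delta *
                \sum_(z in Z)
                  visit_prob p s1 (policy_of_det R pi) z.1.1 z.1.2 z.2 ^+ 2
                  / (visit_count (fun k => X k w) t z.1.1 z.1.2 z.2)%:R)
             + ((#|S| * H)%:R - (on_policy_card Z pi)%:R) * H%:R * eps0].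
Proof.
have [H0|H_gt0] := posnP H.
  subst H; exists setT; split => // [|w _ t _ pi r _].
    by rewrite probability_setT lee_fin gerBl ltW.
  rewrite big_ord0 normr0 mulr0 mul0r addr0.
  exact: sqrtr_ge0.
have bad t := bad_event_le Z p_kernel t sampling delta_gt0.
(* Only times [t >= 1] enter the union; time 0 is treated apart below. *)
exists (~` \bigcup_n bad_event p s1 Z delta X n.+1).
have mbad : measurable (\bigcup_n bad_event p s1 Z delta X n.+1).
  by apply: bigcupT_measurable => t; exact: (bad t).1.
split; first exact: measurableC.
  rewrite probability_setC // EFinB leeB //.
  exact: measure_telescope_union (ltW delta_gt0) (fun t => (bad t).1) (fun t => (bad t).2).
move=> w good t.
have good_t : (0 < t)%N -> ~ bad_event p s1 Z delta X t w.
  by case: t => // t _ bad_w; apply: good; exists t.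
move=> /cover_time_visited visited pi r r01.
have q_empirical := phat_empirical t w; set q := phat t w.
have q_kernel : is_kernel q := q_empirical.1.
have [V [V_bounds valueB]] := simulation pi p_kernel q_kernel r01.
set D := fun z : 'I_H * S =>
  \sum_s' (q z.1 z.2 (pi z.1 z.2) s' - p z.1 z.2 (pi z.1 z.2) s') * V z.1 s'.
have -> : \sum_(h < H) \sum_(s : S) \sum_(a : A)
    (visit_prob q s1 (policy_of_det R pi) h s a
     - visit_prob p s1 (policy_of_det R pi) h s a) * r h s a =
    \sum_(z | on_Z Z pi z) reach p s1 pi z * D z +
    \sum_(z | ~~ on_Z Z pi z) reach p s1 pi z * D z.
  transitivity (\sum_z reach p s1 pi z * D z); last exact: bigID.
  rewrite -(pair_big xpredT xpredT (fun h s => reach p s1 pi (h, s) * D (h, s))) /=.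
  rewrite -valueB /value -sumrB; apply: eq_bigr => h _.
  rewrite -sumrB; apply: eq_bigr => s _.
  by rewrite -sumrB; apply: eq_bigr => a _; rewrite mulrBl.
have w0 h s a : 0 <= visit_prob p s1 (policy_of_det R pi) h s a.
  by rewrite visit_prob_ge0 //; exact: is_policy_of_det.
apply: le_trans (ler_normD _ _) _; apply: lerD.
  have visited_Z z : on_Z Z pi z ->
      (0 < visit_count (fun k => X k w) t z.1 z.2 (pi z.1 z.2))%N.
    by case: z => h s; exact: visited.
  (* At time 0 nothing has been visited, so the policy selects no pair in [Z] and the sum is
     empty. *)
  have [t0|t_gt0] := posnP t.
    rewrite big1 ?normr0 ?sqrtr_ge0 // => z zZ.
    have := visited_Z _ zZ; rewrite t0.
    by rewrite ltnNge visit_count_le.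
  have delta01 : 0 < delta < 1 by rewrite delta_gt0.
  have S_gt0 : (0 < #|S|)%N by apply/card_gt0P; exists s1.
  have A_gt0 : (0 < #|A|)%N by apply/card_gt0P; exists (pi (Ordinal H_gt0) s1).
  have below (i : tilt_index S A H t) :
      \prod_(k < t) episode_weight p (index_policy i) (index_value R i)
        (index_tilt p s1 Z (ln (threshold S A H delta t)) i) (X k w)
      < threshold S A H delta t.
    by rewrite ltNge; apply/negP => le; apply: (good_t t_gt0); exists i.
  apply: le_trans (good_event_deviation p_kernel q_empirical t_gt0 H_gt0 delta01
    below visited_Z V_bounds) _.
  rewrite ler_wsqrtr // ler_wpM2l //.
    (* Multiplying by [beta_RF] is monotone because it dominates a nonnegative quantity. *)
    apply: le_trans (beta_RF_ge t_gt0 H_gt0 S_gt0 A_gt0 delta01).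
    rewrite addr_ge0 // !mulr_ge0 // ?exprn_ge0 // ltW //.
    exact: ln_threshold_gt0.
  apply: (@sum_on_Z_le R S A H Z pi (fun z => visit_prob p s1 (policy_of_det R pi)
    z.1.1 z.1.2 z.2 ^+ 2 / (visit_count (X^~ w) t z.1.1 z.1.2 z.2)%:R)) => z.
  by rewrite divr_ge0 ?sqr_ge0.
apply: le_trans (ler_norm_sum _ _ _) _.
(* Outside [Z] the visit probability is at most [eps0] and the kernel difference at most [H]; there
   are [S H] minus [on_policy_card Z pi] such pairs. *)
apply: (@le_trans _ _ (\sum_(z | ~~ on_Z Z pi z) H%:R * eps0)).
  apply: ler_sum => z zZ; rewrite normrM mulrC ler_pM //.
    apply: (kernel_diff_le p_kernel q_empirical) => s'.
    by have := V_bounds z.1 s'; lra.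
  by rewrite /reach ger0_norm // outside_Z //; case: z zZ.
rewrite sumr_const -[leLHS]mulr_natl -mulrA ler_wpM2r ?mulr_ge0 // ?(ltW eps0_gt0) //.
have -> : (#|S| * H)%N = #|{: 'I_H * S}| by rewrite card_prod card_ord mulnC.
rewrite -(cardC [pred z | on_Z Z pi z]) on_policy_cardE natrD addrAC subrr add0r.
by rewrite ler_nat; apply: eq_leq; apply: eq_card.
Qed.
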